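(* For each $k$ ($0\le k\le K$), as $M\to\infty$, $\varphi^k_M(\mathbf y^{k+1},\dots,\mathbf y^K,\mathbf x)$ converges uniformly to $\varphi^k(\mathbf y^{k+1},\dots,\mathbf y^K,\mathbf x)$ over $\mathbf y^{k'}\in\mathbb R^{n_{k'}}$ ($k+1\le k'\le K$) and $\mathbf x\in\mathbb R^m$.
   Context: There are $m$ products and $n$ components. $A=(a_{ji})$ is an $n\times m$ non-negative integer matrix with at least one non-zero entry in every row and every column. The components are partitioned into $K$ consecutive groups of sizes $n_1,\dots,n_K$ with $\sum_kn_k=n$; $A^k$ is the submatrix of $A$ formed by the rows of group $k$. $\mathbf h\in\mathbb R^n$, $\mathbf b\in\mathbb R^m$ have strictly positive entries, $\mathbf h^k$ is the part of $\mathbf h$ for group $k$, and $\mathbf c=\mathbf b+\sum_{k=1}^K(A^k)'\mathbf h^k$. Demand: lead times $0=L_0<L_1<\dots<L_K$; demand is an $m$-dimensional compound Poisson process $\mathcal D(t)$ with i.i.d. non-negative integer-valued order-size vectors $\mathbf S$, $\mathbf E[S_i^6]<\infty$. $\mathbf D^1,\dots,\mathbf D^K$ are independent, $\mathbf D^k$ having the distribution of $\mathcal D(t-L_{k-1})-\mathcal D(t-L_k)$. For an integer $M>0$, $\mathbf D^k_M=\mathbf D^k\wedge\mathbf M$ (componentwise minimum), $\mathbf M$ being the $m$-vector with all entries $M$. The functions $\varphi^k$ are $$\varphi^K=\inf_{\mathbf y^K\in\mathbb R^{n_K}}\{\mathbf h^K\cdot\mathbf y^K+\mathbf E[\varphi^{K-1}(\mathbf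 y^K,\mathbf D^K)]\},$$ $$\varphi^k(\mathbf y^{k+1},\dots,\mathbf y^K,\mathbf x)=\inf_{\mathbf y^k\in\mathbb R^{n_k}}\{\mathbf h^k\cdot\mathbf y^k+\mathbf E[\varphi^{k-1}(\mathbf y^k,\dots,\mathbf y^K,\mathbf x+\mathbf D^k)]\},\quad1\le k<K,$$ $$\varphi^0(\mathbf y^1,\dots,\mathbf y^K,\mathbf x)=-\max_{\mathbf z\in\mathbb R^m}\{\mathbf c\cdot\mathbf z\mid\mathbf z\le\mathbf x,\ A^k\mathbf z\le\mathbf y^k,\ 1\le k\le K\}.$$ The functions $\varphi^k_M$ are defined by the same recursion with $\mathbf D^k$ replaced by $\mathbf D^k_M$ ($1\le k\le K$) and $\varphi^0_M=\varphi^0$. For $k=K$ both $\varphi^K_M$ and $\varphi^K$ are numbers. *)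

(* Defs.v *)
From HB Require Import structures.
From mathcomp Require Import all_boot all_order all_algebra.
From mathcomp Require Import all_classical all_reals all_analysis.

Set Implicit Arguments.
Unset Strict Implicit.
Unset Printing Implicit Defensive.

Import Order.TTheory GRing.Theory Num.Theory.
Import numFieldNormedType.Exports.

Local Open Scope classical_set_scope.
Local Open Scope ring_scope.

Section probability_notions.
Context {d : measure_display} {T : measurableType d} {R : realType}.

Definition sigma_rv {d'} {U : measurableType d'} (X : T -> U) : set (set T) :=
  preimage_set_system setT X measurable.

Definition mutually_independent (P : probability T R) (I : eqType)
    (F : I -> set (set T)) : Prop :=
  forall (J : seq I) (E : I -> set T), uniq J ->
    (forall i, i \in J -> F i (E i)) ->
    P (\bigcap_(i in [set` J]) E i) = (\prod_(i <- J) P (E i))%E.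

Definition same_law {d1 d2} {T2 : measurableType d2} {U : measurableType d1}
    (P : probability T R) (X : T -> U) (Q : probability T2 R) (Y : T2 -> U) :
    Prop :=
  forall B, measurable B -> P (X @^-1` B) = Q (Y @^-1` B).

(* Only the times t >= 0 are relevant.  Independence of increments is stated
   along infinite nondecreasing sequences of times; a finite subdivision is
   extended to such a sequence by repeating its last point.  Paths being
   nondecreasing, the truncated subtraction on nat is exact. *)
Definition poisson_process (P : probability T R) (rate : R)
    (N : R -> {RV P >-> nat}) : Prop :=
  [/\ forall w, N 0 w = 0%N,
      forall w (s t : R), 0 <= s -> s <= t -> (N s w <= N t w)%N,
      forall w (t : R), 0 <= t -> \forall u \near t^'+, N u w = N t w,
      forall t : nat -> R, 0 <= t 0%N ->
        (forall i j, (i <= j)%N -> t i <= t j) ->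
        mutually_independent P
          (fun i : nat => sigma_rv (fun w => (N (t i.+1) w - N (t i) w)%N))
    & forall (s t : R) k, 0 <= s -> s < t ->
        P [set w | (N t w - N s w)%N = k] =
          (poisson_pmf (rate * (t - s)) k)%:E].

Definition sigma_process (P : probability T R) (N : R -> {RV P >-> nat}) :
    set (set T) :=
  <<s \bigcup_(t in [set t : R | 0 <= t]) sigma_rv (N t) >>.

(* The process N and the vectors S 0, S 1, ... are mutually independent; the
   index None stands for N and Some j for S j. *)
Definition compound_poisson_process (P : probability T R) (m : nat) (rate : R)
    (N : R -> {RV P >-> nat}) (S : nat -> {RV P >-> m.-tuple nat})
    (X : R -> T -> m.-tuple nat) : Prop :=
  [/\ poisson_process rate N,
      forall j, same_law P (S j) P (S 0%N),
      mutually_independent P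
        (fun o : option nat =>
           if o is Some j then sigma_rv (S j) else sigma_process N)
    & forall (t : R) w, 0 <= t ->
        X t w = [tuple (\sum_(j < N t w) tnth (S j w) i)%N | i < m]].

End probability_notions.

(* Exact (not truncated) as soon as u <= v componentwise. *)
Definition diff_tuple (m : nat) (v u : m.-tuple nat) : m.-tuple nat :=
  [tuple (tnth v i - tnth u i)%N | i < m].

Definition truncated {T : Type} {m : nat} (M : nat) (X : T -> m.-tuple nat)
    (w : T) : m.-tuple nat :=
  [tuple minn (tnth (X w) i) M | i < m].

(* Values are extended reals, and (+oo) - (+oo) = -oo in \bar R, so the
   inequality below forces both f M u and g u to be finite. *)
Definition uniform_cvg {R : realType} {U : Type} (f : nat -> U -> \bar R)
    (g : U -> \bar R) : Prop :=
  forall e : R, 0 < e ->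
    \forall M \near \oo, forall u : U, (`|f M u - g u| < e%:E)%E.

Section recursion.
Context {R : realType} {m K : nat} (sz : 'I_K -> nat).

(* Groups are numbered from 0: group k : 'I_K is the (k+1)-st one. *)
Local Notation n := (\sum_(k < K) sz k)%N.

Definition dot {p : nat} (u v : 'cV[R]_p) : R := \sum_i u i 0 * v i 0.

Definition lev {p : nat} (u v : 'cV[R]_p) : Prop :=
  forall i, u i 0 <= v i 0.

Definition block (A : 'M[nat]_(n, m)) (k : 'I_K) : 'M[R]_(sz k, m) :=
  map_mx (fun a : nat => a%:R) (submxcol A k).

Definition cvec (A : 'M[nat]_(n, m)) (h : 'cV[R]_n) (b : 'cV[R]_m) :
    'cV[R]_m :=
  b + \sum_(k < K) (block A k)^T *m submxcol h k.

Definition vec_of_tuple (v : m.-tuple nat) : 'cV[R]_m :=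
  \col_i (tnth v i)%:R.

(* The supremum is a maximum under the standing assumptions (A without zero
   row, b and h positive): the feasible set is closed and nonempty, and its
   subsets where the objective is bounded below are bounded. *)
Definition phi0 (A : 'M[nat]_(n, m)) (h : 'cV[R]_n) (b : 'cV[R]_m)
    (y : forall k, 'cV[R]_(sz k)) (x : 'cV[R]_m) : \bar R :=
  (- ereal_sup [set (dot (cvec A h b) z)%:E |
       z in [set z | lev z x /\ forall k, lev (block A k *m z) (y k)]])%E.

(* [phi A h b P D kK y x] is phi^k(y^(k+1), ..., y^K, x).  The argument y is a
   full family; its members for the first k groups are overwritten by the
   minimizations and hence irrelevant, see [phi_irrelevant]. *)
Fixpoint phi (A : 'M[nat]_(n, m)) (h : 'cV[R]_n) (b : 'cV[R]_m)
    {d} {T : measurableType d} (P : probability T R)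
    (D : 'I_K -> T -> m.-tuple nat) (k : nat) :
    (k <= K)%N -> (forall j, 'cV[R]_(sz j)) -> 'cV[R]_m -> \bar R :=
  match k with
  | 0 => fun _ y x => phi0 A h b y x
  | k'.+1 => fun (kK : (k' < K)%N) y x =>
      let j := Ordinal kK in
      ereal_inf (range (fun v : 'cV[R]_(sz j) =>
        (dot (submxcol h j) v)%:E +
        \int[P]_w phi A h b P D (ltnW kK) (dfwith y j v)
                      (x + vec_of_tuple (D j w)))%E)
  end.

(* phi^K has no argument; its recursion starts from the vector x = 0. *)
Definition phi_top (A : 'M[nat]_(n, m)) (h : 'cV[R]_n) (b : 'cV[R]_m)
    {d} {T : measurableType d} (P : probability T R)
    (D : 'I_K -> T -> m.-tuple nat) : \bar R :=
  phi A h b P D (leqnn K) (fun=> 0) 0.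

Lemma phi_irrelevant (A : 'M[nat]_(n, m)) (h : 'cV[R]_n) (b : 'cV[R]_m)
    {d} {T : measurableType d} (P : probability T R)
    (D : 'I_K -> T -> m.-tuple nat) (k : nat) (kK : (k <= K)%N)
    (y y' : forall j, 'cV[R]_(sz j)) (x : 'cV[R]_m) :
  (forall j : 'I_K, (k <= j)%N -> y j = y' j) ->
  phi A h b P D kK y x = phi A h b P D kK y' x.
Proof.
elim: k kK y y' x => [|k IH] kK y y' x yy' /=.
  by congr (phi0 _ _ _ _ _); apply: functional_extensionality_dep => j; exact: yy'.
congr ereal_inf; apply: eq_imagel => v _; congr (_ + _)%E.
apply: eq_integral => w _; apply: IH => j kj.
have [<-|ne] := eqVneq (Ordinal kK) j; first by rewrite !dfwithin.
rewrite !dfwithout//; apply: yy'; rewrite ltn_neqAle kj andbT.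
by apply: contraNneq ne => e; apply/eqP/val_inj.
Qed.

End recursion.

(* Main.v *)
Require Import Defs.
From HB Require Import structures.
From mathcomp Require Import all_boot all_order all_algebra.
From mathcomp Require Import all_classical all_reals all_analysis.
From mathcomp Require Import measurable_realfun.
From mathcomp Require Import ring lra.

Set Implicit Arguments.
Unset Strict Implicit.
Unset Printing Implicit Defensive.

Import Order.TTheory GRing.Theory Num.Theory.
Import numFieldNormedType.Exports.

Local Open Scope classical_set_scope.
Local Open Scope ring_scope.

(** The uniform estimate comes from the shape of the terminal cost.  Since A is
    non-negative, a point z feasible for the demand x' >= x becomes feasible
    for x after subtracting x' - x, so that phi^0 is antitone in x and
    satisfies phi^0(y, x) <= phi^0(y, x') + c.(x' - x), with a constant that
    depends neither on y nor on x (lemma [phi0_regular]).  Expectations over a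
    demand of finite mean and infima over y^k preserve both properties, so
    every phi^k inherits them with the same c (lemma [phi_regular]).

    Truncation only lowers the demand.  One stage of the recursion therefore
    moves the cost upwards, and by at most c.E[D^k - D^k_M] beyond the error
    already made; after k stages the error lies between 0 and k times the
    largest of these gaps (lemma [phi_compare]).  The bound is free of y and x,
    and the gaps vanish as M grows by dominated convergence
    (lemma [truncation_gap_cvg]).

    Two finiteness facts make these inequalities meaningful.  The infima are
    not -oo: weak duality with the multipliers b and h^k gives
    phi^0 >= - b.x - sum_k h^k.y^k, and each minimization over y^k cancels the
    corresponding term h^k.y^k against its own cost.  The demands have a finite
    mean: D^k is an increment of the compound Poisson process, hence dominated
    by the value of the process at the later time, whose mean is the Poisson
    mean times the mean order size by Wald's identity
    (lemma [nat_mean_lead_time_demand]). *)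

(** * Maps into countable types *)

Section discrete_maps.
Context {d : measure_display} {T : measurableType d}.

(** Measurability for the full power set of the codomain.  Order sizes, demands
    and counts take countably many values, so this form is available for all of
    them.  It survives composition with arbitrary functions, which is how the
    stage costs at a random demand come to be measurable. *)
Definition discretely_measurable {C : Type} (f : T -> C) : Prop :=
  forall B : set C, measurable (f @^-1` B).

Lemma discretely_measurable_fibres {C : countType} (f : T -> C) :
  (forall c, measurable (f @^-1` [set c])) -> discretely_measurable f.
Proof.
move=> mf B; rewrite (_ : _ @^-1` _ = \bigcup_(c in B) f @^-1` [set c]).
  rewrite bigcup_mkcond; apply: countable_bigcupT_measurable => // c.
  by case: ifP.
by apply/seteqP; split => [w /= h|w [c /= Bc ->]//]; exists (f w).
Qed.

Lemma discretely_measurable_pair {C1 C2 : countType} (f : T -> C1)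
    (g : T -> C2) :
  discretely_measurable f -> discretely_measurable g ->
  discretely_measurable (fun w => (f w, g w)).
Proof.
move=> mf mg; apply: discretely_measurable_fibres => -[c1 c2].
rewrite (_ : _ @^-1` _ = f @^-1` [set c1] `&` g @^-1` [set c2]).
  exact: measurableI (mf _) (mg _).
by apply/seteqP; split => w /= [-> ->].
Qed.

Lemma discretely_measurable_comp {C C' : Type} (g : C -> C') (f : T -> C) :
  discretely_measurable f -> discretely_measurable (g \o f).
Proof. by move=> mf B; exact: (mf (g @^-1` B)). Qed.

Lemma discretely_measurable_tuple {m : nat} (f : T -> m.-tuple nat) :
  (forall i, discretely_measurable (fun w => tnth (f w) i)) ->
  discretely_measurable f.
Proof.
move=> mf; apply: discretely_measurable_fibres => v.
rewrite (_ : _ @^-1` _ =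
    \bigcap_(i in [set: 'I_m]) (fun w => tnth (f w) i) @^-1` [set tnth v i]).
  by apply: fin_bigcap_measurable => // i _; exact: mf.
apply/seteqP; split => [w /= <- //|w /= h].
by apply: eq_from_tnth => i; exact: h.
Qed.

(** Splitting along the values of [N] reduces to sums of a fixed length. *)
Lemma discretely_measurable_random_sum (N : T -> nat) (a : nat -> T -> nat) :
  discretely_measurable N -> (forall j, discretely_measurable (a j)) ->
  discretely_measurable (fun w => \sum_(j < N w) a j w)%N.
Proof.
move=> mN ma; have msum n : discretely_measurable (fun w => \sum_(j < n) a j w)%N.
  elim: n => [|n IH].
    under eq_fun do rewrite big_ord0.
    by apply: discretely_measurable_fibres => c; rewrite preimage_cst; case: ifP.
  under eq_fun do rewrite big_ord_recr.
  exact: (discretely_measurable_comp (fun p : nat * nat => (p.1 + p.2)%N)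
    (discretely_measurable_pair IH (ma n))).
move=> B; rewrite (_ : _ @^-1` _ = \bigcup_n
    (N @^-1` [set n] `&` (fun w => \sum_(j < n) a j w)%N @^-1` B)).
  by apply: bigcupT_measurable => n; exact: measurableI (mN _) (msum _ _).
by apply/seteqP; split => [w /= h|w [n _ [/= <-]]//]; exists (N w).
Qed.

Lemma discretely_measurable_RV {R : realType} {d' : measure_display}
    {U : measurableType d'} (P : probability T R) (X : {RV P >-> U}) :
  (forall B : set U, measurable B) -> discretely_measurable X.
Proof.
move=> mU B; have := @measurable_funPT _ _ _ _ X measurableT B (mU B).
by rewrite setTI.
Qed.

Lemma discretely_measurable_fun {C : Type} {d' : measure_display}
    {U : measurableType d'} (f : T -> C) (g : C -> U) :
  discretely_measurable f -> measurable_fun setT (fun w => g (f w)).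
Proof. by move=> mf _ B _; rewrite setTI; exact: (mf (g @^-1` B)). Qed.

End discrete_maps.

(** The product sigma-algebra on tuples of naturals is discrete, because there
    are countably many tuples and each coordinate has a discrete range. *)
Lemma measurable_tuple_nat (m : nat) (B : set (m.-tuple nat)) : measurable B.
Proof.
apply: (discretely_measurable_tuple (f := id)) => i A.
by have := @measurable_tnth _ nat m i measurableT A I; rewrite setTI.
Qed.

(** * Means of non-negative integer variables *)

Section nonnegative_integer_expectations.
Context {d : measure_display} {T : measurableType d} {R : realType}.
Variable P : probability T R.
Local Open Scope ereal_scope.

Definition nat_mean (X : T -> nat) : \bar R := \int[P]_w ((X w)%:R : R)%:E.

Lemma nat_mean_ge0 (X : T -> nat) : 0 <= nat_mean X.
Proof. by apply: integral_ge0 => w _; rewrite lee_fin. Qed.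

(** Writing a sum with a variable number of terms as a series with a fixed index
    set is what allows the expectation to be taken term by term. *)
Lemma sum_nat_eseries (a : nat -> nat) (n : nat) :
  ((\sum_(j < n) a j)%N%:R : R)%:E =
  \sum_(j <oo) (((if (j < n)%N then a j else 0%N)%:R : R)%:E).
Proof.
rewrite (nneseries_split 0 n); last by move=> k _; rewrite lee_fin.
rewrite add0n eseries0 ?adde0; last first.
  by move=> k nk _; rewrite ltnNge nk.
rewrite big_mkord natr_sum -sumEFin; apply: eq_bigr => j _.
by rewrite ltn_ord.
Qed.

Lemma nat_mean_random_sum (N : T -> nat) (a : nat -> T -> nat) :
  discretely_measurable N -> (forall j, discretely_measurable (a j)) ->
  nat_mean (fun w => \sum_(j < N w) a j w)%N =
  \sum_(j <oo) nat_mean (fun w => if (j < N w)%N then a j w else 0%N).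
Proof.
move=> mN ma; rewrite -integral_nneseries//.
- by apply: eq_integral => w _; rewrite (sum_nat_eseries (a ^~ w)).
- move=> j.
  exact: (discretely_measurable_fun
    (fun p : nat * nat => ((if (j < p.1)%N then p.2 else 0%N)%:R : R)%:E)
    (discretely_measurable_pair mN (ma j))).
- by move=> j w _; rewrite lee_fin.
Qed.

Lemma nat_mean_bool (B : T -> bool) : discretely_measurable B ->
  nat_mean B = P [set w | B w].
Proof.
move=> mB; rewrite -[in RHS](setIT [set w | B w]) -integral_indic//; last first.
  exact: (mB [set b | b]).
apply: eq_integral => w _; rewrite indicE; congr (_%:R%:E).
by congr nat_of_bool; apply/idP/idP; rewrite inE.
Qed.

(** A natural number is a random sum of ones. *)
Lemma nat_mean_tail (X : T -> nat) : discretely_measurable X ->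
  nat_mean X = \sum_(v <oo) P [set w | (v < X w)%N].
Proof.
move=> mX.
transitivity (nat_mean (fun w => \sum_(j < X w) 1)%N).
  by apply: eq_integral => w _; rewrite sum1_card card_ord.
rewrite (@nat_mean_random_sum X (fun _ _ => 1%N))//; last first.
  by move=> j B; rewrite preimage_cst; case: ifP.
apply: eq_eseriesr => v _; rewrite -nat_mean_bool.
  by apply: eq_integral => w _; case: ltnP.
exact: (discretely_measurable_comp (fun n => v < n)%N mX).
Qed.

(** Independence enters only through the tails of [X]: the tails of the product
    of [X] with the indicator of [B] factor, and the tail formula sums them. *)
Lemma nat_mean_indep_restrict (X : T -> nat) (B : T -> bool) :
  discretely_measurable B -> discretely_measurable X ->
  (forall v, P ([set w | B w] `&` [set w | (v < X w)%N]) =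
             P [set w | B w] * P [set w | (v < X w)%N]) ->
  nat_mean (fun w => if B w then X w else 0%N) = P [set w | B w] * nat_mean X.
Proof.
move=> mB mX ind; rewrite !nat_mean_tail//; last first.
  exact: (discretely_measurable_comp (fun p : bool * nat => if p.1 then p.2 else 0%N)
    (discretely_measurable_pair mB mX)).
have finB : P [set w | B w] \is a fin_num.
  exact: (fin_num_measure P _ (mB [set b | b])).
rewrite -(fineK finB) -nneseriesZl//; apply: eq_eseriesr => v _.
rewrite fineK// -ind; congr (P _); apply/seteqP; split => w /=; case: (B w) => //.
  by case.
by case.
Qed.

(** The [j]-th term contributes exactly when [j < N], an event independent of
    [a j]; summing the probabilities of these events gives the mean of [N]. *)
Lemma wald_identity (N : T -> nat) (a : nat -> T -> nat) :
  discretely_measurable N -> (forall j, discretely_measurable (a j)) ->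
  (forall j v, P ([set w | (j < N w)%N] `&` [set w | (v < a j w)%N]) =
               P [set w | (j < N w)%N] * P [set w | (v < a j w)%N]) ->
  (forall j, nat_mean (a j) = nat_mean (a 0%N)) ->
  nat_mean (a 0%N) < +oo ->
  nat_mean (fun w => \sum_(j < N w) a j w)%N = nat_mean N * nat_mean (a 0%N).
Proof.
move=> mN ma ind same fin.
rewrite nat_mean_random_sum// (nat_mean_tail mN) muleC.
have fin0 : nat_mean (a 0%N) \is a fin_num by rewrite ge0_fin_numE ?nat_mean_ge0.
rewrite -(fineK fin0) -nneseriesZl//; apply: eq_eseriesr => j _.
rewrite fineK// muleC -(same j).
apply: (@nat_mean_indep_restrict (a j) (fun w => j < N w)%N) => //.
exact: (discretely_measurable_comp (fun n => j < n)%N mN).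
Qed.

Lemma ge0_integral_nat_law (N : T -> nat) (g : nat -> R) :
  discretely_measurable N -> (forall k, (0 <= g k)%R) ->
  \int[P]_w (g (N w))%:E = \sum_(k <oo) (g k)%:E * P [set w | N w = k].
Proof.
move=> mN g0.
transitivity (\int[P]_w \sum_(k <oo) ((g k)%:E * (\1_[set w | N w = k] w)%:E)).
  apply: eq_integral => w _; rewrite (nneseriesD1 (n := N w))//; last first.
    by move=> k _; rewrite mule_ge0 ?lee_fin.
  rewrite indicE mem_set//= mule1 eseries0 ?adde0// => k _ /= kN.
  by rewrite indicE memNset ?mule0// => /= e; rewrite e eqxx in kN.
rewrite integral_nneseries//.
- apply: eq_eseriesr => k _; rewrite ge0_integralZl//.
  + by rewrite integral_indic ?setIT//; exact: (mN [set k]).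
  + apply/measurable_EFinP; apply: measurable_indic; exact: (mN [set k]).
  + by rewrite lee_fin.
- move=> k; apply: measurable_funeM; apply/measurable_EFinP.
  by apply: measurable_indic; exact: (mN [set k]).
- by move=> k w _; rewrite mule_ge0 ?lee_fin.
Qed.

(** The first moment reduces to the total mass through
    [(k + 1) * pmf (k + 1) = r * pmf k]; the total mass is 1 since the law of
    [N] is a probability. *)
Lemma nat_mean_poisson (N : T -> nat) (r : R) :
  (0 < r)%R -> discretely_measurable N ->
  (forall k, P [set w | N w = k] = (poisson_pmf r k)%:E) ->
  nat_mean N = r%:E.
Proof.
move=> r0 mN law.
have pmf1 : \sum_(k <oo) (poisson_pmf r k)%:E = 1.
  transitivity (\int[P]_w (1%R : R)%:E); last first.
    by rewrite integral_cst// mul1e; exact: probability_setT.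
  rewrite (@ge0_integral_nat_law N (fun=> 1%R))//.
  by apply: eq_eseriesr => k _; rewrite mul1e law.
rewrite /nat_mean (@ge0_integral_nat_law N (fun k => k%:R))//.
rewrite nneseries_recl//; last by move=> k _; rewrite mule_ge0 ?lee_fin.
rewrite mul0e add0e -nneseries_addn//; last first.
  by move=> i; rewrite mule_ge0 ?lee_fin.
rewrite -[r in RHS]mulr1 EFinM -pmf1 -nneseriesZl//; last first.
  by move=> k _; rewrite lee_fin poisson_pmf_ge0.
apply: eq_eseriesr => k _; rewrite law -!EFinM addn1; congr _%:E.
rewrite /poisson_pmf r0 exprS factS natrM invfM.
by field; rewrite -mulrS !pnatr_eq0 -lt0n fact_gt0.
Qed.

End nonnegative_integer_expectations.

(** * Lead time demands have a finite mean *)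

Section compound_poisson_mean.
Local Open Scope ereal_scope.

Lemma mutually_independent_pair {d : measure_display} {T : measurableType d}
    {R : realType} (P : probability T R) (I : eqType) (F : I -> set (set T))
    (i j : I) (A B : set T) :
  mutually_independent P F -> i != j -> F i A -> F j B ->
  P (A `&` B) = P A * P B.
Proof.
move=> ind ij FA FB.
have := ind [:: i; j] (fun k => if k == i then A else B).
rewrite /= inE ij /= => /(_ isT).
rewrite !big_cons big_nil eqxx eq_sym (negbTE ij) mule1 => <-.
  congr (P _); apply/seteqP; split => [w [Aw Bw] k _|w h]; first by case: ifP.
  split; first by have := h i; rewrite /= eqxx; apply; rewrite !inE eqxx.
  have := h j; rewrite /= eq_sym (negbTE ij); apply.
  by rewrite !inE eqxx orbT.
move=> k; rewrite !inE => /orP[] /eqP ->; first by rewrite eqxx.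
by rewrite eq_sym (negbTE ij).
Qed.

Lemma nat_mean_same_law {d1 d2 d3 : measure_display} {T1 : measurableType d1}
    {T2 : measurableType d2} {U : measurableType d3} {R : realType}
    (P : probability T1 R)
    (Q : probability T2 R) (X : T1 -> U) (Y : T2 -> U) (g : U -> nat) :
  (forall B : set U, measurable B) ->
  discretely_measurable X -> discretely_measurable Y -> same_law P X Q Y ->
  nat_mean P (g \o X) = nat_mean Q (g \o Y).
Proof.
move=> mU mX mY same; rewrite !nat_mean_tail; do ?exact: discretely_measurable_comp.
by apply: eq_eseriesr => v _; exact: (same [set u | (v < g u)%N]).
Qed.

Lemma le_nat_mean {d : measure_display} {T : measurableType d} {R : realType}
    (P : probability T R) (X Y : T -> nat) :
  discretely_measurable X -> discretely_measurable Y ->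
  (forall w, X w <= Y w)%N -> nat_mean P X <= nat_mean P Y.
Proof.
move=> mX mY XY; apply: ge0_le_integral => //.
- exact: (discretely_measurable_fun (fun n : nat => (n%:R : R)%:E) mX).
- exact: (discretely_measurable_fun (fun n : nat => (n%:R : R)%:E) mY).
- by move=> w _; rewrite lee_fin ler_nat.
Qed.

Section process.
Context {R : realType} {m : nat} {d : measure_display} {T : measurableType d}.
Context {Q : probability T R} {rate : R} {N : R -> {RV Q >-> nat}}.
Context {S : nat -> {RV Q >-> m.-tuple nat}} {X : R -> T -> m.-tuple nat}.
Hypothesis rate_gt0 : (0 < rate)%R.
Hypothesis X_cpp : compound_poisson_process rate N S X.

Lemma discretely_measurable_arrivals (s : R) : discretely_measurable (N s).
Proof. exact: discretely_measurable_RV. Qed.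

Lemma discretely_measurable_order (j : nat) (i : 'I_m) :
  discretely_measurable (fun w => tnth (S j w) i).
Proof.
have mS : discretely_measurable (S j).
  exact: discretely_measurable_RV (@measurable_tuple_nat m).
exact: (discretely_measurable_comp (fun v : m.-tuple nat => tnth v i) mS).
Qed.

Lemma tnth_compound_poisson (s : R) (i : 'I_m) : (0 <= s)%R ->
  (fun w => tnth (X s w) i) = (fun w => \sum_(j < N s w) tnth (S j w) i)%N.
Proof.
move=> s0; case: X_cpp => _ _ _ XE.
by apply/funext => w; rewrite XE// tnth_mktuple.
Qed.

Lemma discretely_measurable_compound_poisson (s : R) : (0 <= s)%R ->
  discretely_measurable (X s).
Proof.
move=> s0; apply: discretely_measurable_tuple => i.
rewrite tnth_compound_poisson//.
apply: (discretely_measurable_random_sum (a := fun j w => tnth (S j w) i)).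
  exact: discretely_measurable_arrivals.
by move=> j; exact: discretely_measurable_order.
Qed.

Lemma nat_mean_arrivals (s : R) : (0 < s)%R ->
  nat_mean Q (N s) = (rate * s)%:E.
Proof.
move=> s0; case: X_cpp => -[N0 _ _ _ law] _ _ _.
apply: nat_mean_poisson => [||k].
- exact: mulr_gt0.
- exact: discretely_measurable_arrivals.
- have := law 0%R s k (lexx _) s0; rewrite subr0 => <-.
  by congr (Q _); apply/funext => w /=; rewrite N0 subn0.
Qed.

Lemma nat_mean_compound_poisson (s : R) (i : 'I_m) : (0 < s)%R ->
  nat_mean Q (fun w => tnth (S 0%N w) i) < +oo ->
  nat_mean Q (fun w => tnth (X s w) i) < +oo.
Proof.
move=> s0 Sfin; have [_ same ind _] := X_cpp.
rewrite tnth_compound_poisson ?(ltW s0)//.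
rewrite (@wald_identity _ _ _ _ (N s) (fun j w => tnth (S j w) i))//.
- rewrite nat_mean_arrivals// lte_mul_pinfty// lee_fin mulr_ge0// ltW//.
- exact: discretely_measurable_arrivals.
- by move=> j; exact: discretely_measurable_order.
- move=> j v; apply: (mutually_independent_pair (i := None) (j := Some j) ind) => //.
    apply: sub_gen_smallest; exists s; first exact: ltW.
    by exists [set n | (j < n)%N] => //; rewrite setTI.
  exists [set u : m.-tuple nat | (v < tnth u i)%N]; last by rewrite setTI.
  exact: measurable_tuple_nat.
- move=> j; apply: (nat_mean_same_law (fun u : m.-tuple nat => tnth u i)).
  + exact: measurable_tuple_nat.
  + exact: discretely_measurable_RV (@measurable_tuple_nat m).
  + exact: discretely_measurable_RV (@measurable_tuple_nat m).
  + exact: same.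
Qed.

(** Integer order sizes are bounded by their sixth powers. *)
Lemma nat_mean_order_lty (i : 'I_m) :
  \int[Q]_w ((tnth (S 0%N w) i)%:R ^+ 6 : R)%:E < +oo ->
  nat_mean Q (fun w => tnth (S 0%N w) i) < +oo.
Proof.
apply: le_lt_trans; pose X6 w := (tnth (S 0%N w) i ^ 6)%N.
rewrite [leRHS](_ : _ = nat_mean Q X6); last first.
  by apply: eq_integral => w _; rewrite natrX.
have mS := discretely_measurable_order 0 i.
apply: le_nat_mean => //; first exact: (discretely_measurable_comp (fun n => (n ^ 6)%N) mS).
by move=> w; rewrite /X6; case: (tnth _ _) => // n; rewrite -{1}[n.+1]expn1 leq_pexp2l.
Qed.

(** The increment between [u] and [s] is at most the value at time [s], to which
    Wald's identity applies. *)
Lemma nat_mean_lead_time_demand (s u : R) (i : 'I_m)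
    {d' : measure_display} {T' : measurableType d'} (P : probability T' R)
    (D : {RV P >-> m.-tuple nat}) :
  (0 <= u)%R -> (u < s)%R ->
  \int[Q]_w ((tnth (S 0%N w) i)%:R ^+ 6 : R)%:E < +oo ->
  same_law P D Q (fun w => diff_tuple (X s w) (X u w)) ->
  nat_mean P (fun w => tnth (D w) i) < +oo.
Proof.
move=> u0 us S6 same; have s0 := le_lt_trans u0 us.
have mXs := discretely_measurable_compound_poisson (ltW s0).
have mXu := discretely_measurable_compound_poisson u0.
have mdiff : discretely_measurable (fun w => diff_tuple (X s w) (X u w)).
  exact: (discretely_measurable_comp
    (fun p : m.-tuple nat * m.-tuple nat => diff_tuple p.1 p.2)
    (discretely_measurable_pair mXs mXu)).
pose p (v : m.-tuple nat) := tnth v i.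
rewrite [ltLHS](_ : _ = nat_mean P (p \o D))//.
rewrite (nat_mean_same_law _ _ _ mdiff same); last 2 first.
- exact: measurable_tuple_nat.
- exact: discretely_measurable_RV (@measurable_tuple_nat m).
apply: le_lt_trans (nat_mean_compound_poisson s0 (nat_mean_order_lty S6)).
apply: le_nat_mean.
- exact: (discretely_measurable_comp p mdiff).
- exact: (discretely_measurable_comp p mXs).
- by move=> w; rewrite /p /= tnth_mktuple leq_subr.
Qed.

End process.
End compound_poisson_mean.

(** * Dot products *)

Section dot_product.
Context {R : realType} {p : nat}.
Implicit Types u v : 'cV[R]_p.

Lemma dotDl u u' v : dot (u + u') v = dot u v + dot u' v.
Proof. by rewrite -big_split; apply: eq_bigr => i _; rewrite mxE mulrDl. Qed.

Lemma dotDr u v v' : dot u (v + v') = dot u v + dot u v'.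
Proof. by rewrite -big_split; apply: eq_bigr => i _; rewrite mxE mulrDr. Qed.

Lemma dotBr u v v' : dot u (v - v') = dot u v - dot u v'.
Proof. by rewrite -sumrB; apply: eq_bigr => i _; rewrite !mxE mulrBr. Qed.

Lemma dot_suml {I : finType} (u : I -> 'cV[R]_p) v :
  dot (\sum_k u k) v = \sum_k dot (u k) v.
Proof.
rewrite exchange_big; apply: eq_bigr => i _.
by rewrite summxE mulr_suml.
Qed.

Lemma dot_trmx {q : nat} (B : 'M[R]_(q, p)) (u : 'cV[R]_q) v :
  dot (B^T *m u) v = dot u (B *m v).
Proof.
have dotE r (a a' : 'cV[R]_r) : dot a a' = (a^T *m a') 0 0.
  by rewrite mxE; apply: eq_bigr => i _; rewrite mxE.
by rewrite !dotE trmx_mul trmxK mulmxA.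
Qed.

Lemma le_dot u v v' : lev 0 u -> lev v v' -> dot u v <= dot u v'.
Proof.
move=> u0 vv'; apply: ler_sum => i _; apply: ler_wpM2l => //.
by have := u0 i; rewrite mxE.
Qed.

Lemma dot_ge0 u v : lev 0 u -> lev 0 v -> 0 <= dot u v.
Proof.
move=> u0 v0; apply: sumr_ge0 => i _.
by have := u0 i; have := v0 i; rewrite !mxE => ? ?; exact: mulr_ge0.
Qed.

End dot_product.

(** * Antitone functions with a one-sided Lipschitz bound *)

Section regular_functions.
Context {R : realType} {m : nat}.
Variable c : 'cV[R]_m.
Hypothesis c_ge0 : lev 0 c.
Local Open Scope ereal_scope.

(** The invariant carried through the recursion.  The bound is weighted by [c]
    and stated for comparable points only: truncated and full demands are
    always comparable, and in this form expectations and infima preserve it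
    without any loss in the constant. *)
Definition regular (f : 'cV[R]_m -> \bar R) : Prop :=
  (forall x, f x \is a fin_num) /\
  (forall x x', lev x x' ->
     f x' <= f x /\ f x <= f x' + (dot c (x' - x))%:E).

Lemma regular_addl (r : R) (f : 'cV[R]_m -> \bar R) :
  regular f -> regular (fun x => r%:E + f x).
Proof.
move=> [finf lipf]; split => [x|x x' xx']; first by rewrite fin_numD finf.
have [le1 le2] := lipf _ _ xx'; split; first exact: leeD2l.
by rewrite -addeA leeD2l.
Qed.

(** The lower bound [lb] excludes the value -oo and the index [v0] excludes +oo;
    the Lipschitz bound is the same for all [v], hence passes to the infimum. *)
Lemma regular_inf {V : Type} (v0 : V) (F : V -> 'cV[R]_m -> \bar R)
    (lb : 'cV[R]_m -> R) :
  (forall v, regular (F v)) -> (forall v x, (lb x)%:E <= F v x) ->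
  regular (fun x => ereal_inf (range (F^~ x))).
Proof.
move=> regF lbF; split => [x|x x' xx'].
  rewrite fin_numElt; apply/andP; split.
    apply: (@lt_le_trans _ _ (lb x)%:E); first exact: ltNyr.
    by apply: le_ereal_inf_tmp => _ [v _ <-]; exact: lbF.
  apply: (@le_lt_trans _ _ (F v0 x)).
    by apply: ereal_inf_lbound; exists v0.
  by rewrite ltey_eq (regF v0).1.
split.
  apply: le_ereal_inf_tmp => _ [v _ <-].
  apply: le_trans ((regF v).2 _ _ xx').1.
  by apply: ereal_inf_lbound; exists v.
rewrite -leeBlDr//; apply: le_ereal_inf_tmp => _ [v _ <-].
rewrite leeBlDr//; apply: le_trans ((regF v).2 _ _ xx').2.
by apply: ereal_inf_lbound; exists v.
Qed.

Lemma le_ereal_inf_shift {V : Type} (F G : V -> \bar R) (e : R) :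
  (forall v, F v <= G v /\ G v <= F v + e%:E) ->
  ereal_inf (range F) <= ereal_inf (range G) /\
  ereal_inf (range G) <= ereal_inf (range F) + e%:E.
Proof.
move=> FG; split; last rewrite -leeBlDr//; apply: le_ereal_inf_tmp => _ [v _ <-].
  by apply: le_trans (FG v).1; apply: ereal_inf_lbound; exists v.
rewrite leeBlDr//; apply: le_trans (FG v).2.
by apply: ereal_inf_lbound; exists v.
Qed.

Context {d : measure_display} {T : measurableType d}.
Variable P : probability T R.

Lemma integral_EFin_cst (r : R) : \int[P]_w (EFin \o cst r) w = r%:E.
Proof.
rewrite [LHS](_ : _ = \int[P]_w r%:E)// integral_cst//.
by rewrite -[RHS]mule1; congr (_ * _); exact: probability_setT.
Qed.

Definition integrable_demand (D : T -> m.-tuple nat) : Prop :=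
  discretely_measurable D /\
  forall i, nat_mean P (fun w => tnth (D w) i) < +oo.

Definition mean_demand (D : T -> m.-tuple nat) : 'cV[R]_m :=
  \col_i fine (nat_mean P (fun w => tnth (D w) i)).

Lemma integrable_coordinate (D : T -> m.-tuple nat) (i : 'I_m) :
  integrable_demand D ->
  P.-integrable setT (fun w => ((tnth (D w) i)%:R : R)%:E).
Proof.
move=> [mD finD]; apply/integrableP; split.
  exact: (discretely_measurable_fun
    (fun v : m.-tuple nat => ((tnth v i)%:R : R)%:E) mD).
rewrite (eq_integral (fun w => ((tnth (D w) i)%:R : R)%:E)); first exact: finD.
by move=> w _; rewrite /= ger0_norm.
Qed.

Lemma integrable_dot (u : 'cV[R]_m) (D : T -> m.-tuple nat) :
  integrable_demand D ->
  P.-integrable setT (fun w => (dot u (vec_of_tuple (D w)))%:E).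
Proof.
move=> iD; rewrite (_ : (fun _ => _) =
    fun w => \sum_i (u i 0)%:E * ((tnth (D w) i)%:R)%:E).
  apply: integrable_sum => // i _; apply: integrableZl => //.
  exact: integrable_coordinate.
by apply/funext => w; rewrite -sumEFin; apply: eq_bigr => i _; rewrite mxE.
Qed.

Lemma integral_dot (u : 'cV[R]_m) (D : T -> m.-tuple nat) :
  integrable_demand D ->
  \int[P]_w (dot u (vec_of_tuple (D w)))%:E = (dot u (mean_demand D))%:E.
Proof.
move=> iD.
transitivity (\int[P]_w \sum_i (u i 0)%:E * ((tnth (D w) i)%:R : R)%:E).
  apply: eq_integral => w _; rewrite -sumEFin.
  by apply: eq_bigr => i _; rewrite mxE.
rewrite integral_sum//; last first.
  by move=> i; apply: integrableZl => //; exact: integrable_coordinate.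
rewrite -sumEFin; apply: eq_bigr => i _.
rewrite integralZl//; last exact: integrable_coordinate.
rewrite mxE EFinM fineK// ge0_fin_numE ?nat_mean_ge0//; exact: iD.2.
Qed.

Lemma lev_addr_demand (x : 'cV[R]_m) (v : m.-tuple nat) :
  lev x (x + vec_of_tuple v).
Proof. by move=> i; rewrite !mxE lerDl. Qed.

(** The shifted value is within [c.D] of [f x], which has a finite mean. *)
Lemma integrable_regular (f : 'cV[R]_m -> \bar R) (D : T -> m.-tuple nat)
    (x : 'cV[R]_m) :
  regular f -> integrable_demand D ->
  P.-integrable setT (fun w => f (x + vec_of_tuple (D w))%R).
Proof.
move=> [finf lipf] iD.
apply: (@le_integrable _ _ _ _ _ _ _
  (fun w => `|f x| + (dot c (vec_of_tuple (D w)))%:E)) => //.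
- exact: (discretely_measurable_fun
    (fun v : m.-tuple nat => f (x + vec_of_tuple v)%R) iD.1).
- move=> w _; set v := vec_of_tuple (D w).
  have [] := lipf _ _ (lev_addr_demand x (D w)).
  rewrite -/v addrAC subrr add0r.
  rewrite -(fineK (finf x)) -(fineK (finf (x + v)%R)) /= -!EFinD /= !lee_fin.
  move=> le1 le2; rewrite [leRHS]ger0_norm; last first.
    rewrite addr_ge0//; apply: dot_ge0 => // i.
    by rewrite !mxE.
  rewrite ler_norml; apply/andP; split.
    by have := ler_norm (- fine (f x)); rewrite normrN; lra.
  by have := ler_norm (fine (f x)); lra.
- apply: integrableD => //; last exact: integrable_dot.
  by rewrite -(fineK (finf x)); exact: finite_measure_integrable_cst.
Qed.

Lemma regular_expectation (f : 'cV[R]_m -> \bar R) (D : T -> m.-tuple nat) :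
  regular f -> integrable_demand D ->
  regular (fun x => \int[P]_w f (x + vec_of_tuple (D w))%R).
Proof.
move=> regf iD; have intf x := integrable_regular x regf iD.
split => [x|x x' xx']; first exact: integrable_fin_num.
have shift w : lev (x + vec_of_tuple (D w)) (x' + vec_of_tuple (D w)).
  by move=> i; rewrite mxE [in leRHS]mxE lerD2r; exact: xx'.
split; first by apply: le_integral => // w _; exact: (regf.2 _ _ (shift w)).1.
have intc : P.-integrable setT (EFin \o cst (dot c (x' - x))).
  exact: finite_measure_integrable_cst.
rewrite -integral_EFin_cst -integralD//; apply: le_integral => //.
  exact: integrableD.
move=> w _; have [_] := regf.2 _ _ (shift w).
by rewrite opprD addrACA subrr addr0.
Qed.

(** The effect of one expectation on the error: passing from [f] to [g] costs
    [e], and passing from the demand [D] to the smaller demand [E] costs the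
    mean of [c.(D - E)]; both changes increase the cost. *)
Lemma expectation_compare (f g : 'cV[R]_m -> \bar R)
    (D E : T -> m.-tuple nat) (e : R) (x : 'cV[R]_m) :
  regular f -> regular g -> integrable_demand D -> integrable_demand E ->
  (forall w i, tnth (E w) i <= tnth (D w) i)%N ->
  (forall x, f x <= g x /\ g x <= f x + e%:E) ->
  \int[P]_w f (x + vec_of_tuple (D w))%R <=
    \int[P]_w g (x + vec_of_tuple (E w))%R /\
  \int[P]_w g (x + vec_of_tuple (E w))%R <=
    \int[P]_w f (x + vec_of_tuple (D w))%R +
    (e + dot c (mean_demand D - mean_demand E))%:E.
Proof.
move=> regf regg iD iE ED fg.
have intf := integrable_regular x regf iD.
have intg := integrable_regular x regg iE.
have lexED w : lev (x + vec_of_tuple (E w)) (x + vec_of_tuple (D w)).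
  by move=> i; rewrite !mxE lerD2l ler_nat.
split.
  apply: le_integral => // w _; apply: le_trans (fg _).1.
  exact: (regf.2 _ _ (lexED w)).1.
have inte : P.-integrable setT (EFin \o cst e).
  exact: finite_measure_integrable_cst.
have intDE : P.-integrable setT (fun w => (dot c (vec_of_tuple (D w)))%:E -
     (dot c (vec_of_tuple (E w)))%:E).
  by apply: integrableB => //; exact: integrable_dot.
rewrite dotBr EFinD EFinB -!integral_dot// -integralB//; try exact: integrable_dot.
rewrite -integral_EFin_cst -integralD// -integralD//; last exact: integrableD.
apply: le_integral => //; first by apply: integrableD => //; exact: integrableD.
move=> w _; apply: le_trans (fg _).2 _.
rewrite /= [leRHS]addeCA [leLHS]addeC leeD2l//.
have [_] := regf.2 _ _ (lexED w).
by rewrite opprD addrACA subrr add0r dotBr EFinB.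
Qed.

End regular_functions.

(** * The cost functions *)

Section stage_costs.
Context {R : realType} {m K : nat} {sz : 'I_K -> nat}.
Variables (A : 'M[nat]_((\sum_(k < K) sz k)%N, m))
  (h : 'cV[R]_((\sum_(k < K) sz k)%N)) (b : 'cV[R]_m).
Hypotheses (A_row : forall j, exists i, A j i != 0%N)
  (h_gt0 : forall j, 0 < h j 0) (b_gt0 : forall i, 0 < b i 0).

Implicit Types (y : forall k, 'cV[R]_(sz k)) (x z : 'cV[R]_m).

Local Notation c := (cvec A h b).

Lemma block_ge0 (k : 'I_K) i l : 0 <= block A k i l :> R.
Proof. by rewrite !mxE. Qed.

Lemma le_block_mul (k : 'I_K) z z' :
  lev z z' -> lev (block A k *m z) (block A k *m z').
Proof.
move=> zz' i; rewrite !mxE; apply: ler_sum => l _.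
by apply: ler_wpM2l => //; exact: block_ge0.
Qed.

Lemma submxcol_ge0 (k : 'I_K) : lev 0 (submxcol h k).
Proof. by move=> i; rewrite !mxE ltW. Qed.

Lemma cvec_ge0 : lev 0 c.
Proof.
move=> i; rewrite [leLHS]mxE mxE summxE addr_ge0 ?(ltW (b_gt0 _))//.
apply: sumr_ge0 => k _; rewrite mxE; apply: sumr_ge0 => l _.
apply: mulr_ge0; first by rewrite mxE block_ge0.
by have := submxcol_ge0 l; rewrite mxE.
Qed.

Lemma dot_cvec z :
  dot c z = dot b z + \sum_(k < K) dot (submxcol h k) (block A k *m z).
Proof.
rewrite dotDl dot_suml; congr (_ + _).
by apply: eq_bigr => k _; rewrite dot_trmx.
Qed.

Definition feasible y x : set 'cV[R]_m :=
  [set z | lev z x /\ forall k, lev (block A k *m z) (y k)].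

(** The multipliers [b] for the demand constraints and [h] for the component
    constraints are dual feasible, by the very definition of [c]. *)
Lemma weak_duality y x z : feasible y x z ->
  dot c z <= dot b x + \sum_(k < K) dot (submxcol h k) (y k).
Proof.
move=> [zx Azy]; rewrite dot_cvec lerD//.
  by apply: le_dot => // i; rewrite mxE ltW.
apply: ler_sum => k _; apply: le_dot => //; exact: submxcol_ge0.
Qed.

(** Every row of [A] has an entry at least 1, so a sufficiently negative constant
    vector satisfies all constraints. *)
Lemma feasible_nonempty y x : feasible y x !=set0.
Proof.
pose t : R := \sum_i `|x i 0| + \sum_(k < K) \sum_i `|y k i 0|.
have t0 : 0 <= t.
  by rewrite addr_ge0// sumr_ge0// => k _; rewrite sumr_ge0.
exists (const_mx (- t)); split => [i|k i].
  rewrite mxE lerNl /t (bigD1 i)//= -addrA.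
  apply: le_trans (_ : `|x i 0| <= _); first by rewrite -normrN ler_norm.
  rewrite lerDl addr_ge0// sumr_ge0// => k _; exact: sumr_ge0.
have row : 1 <= \sum_l block A k i l :> R.
  have [l] := A_row (tagnat.Rank k i).
  rewrite -lt0n => Akl; rewrite (bigD1 l)//= -[leLHS]addr0 lerD//.
    by rewrite !mxE ler1n.
  by apply: sumr_ge0 => l' _; exact: block_ge0.
rewrite mxE; under eq_bigr do rewrite [const_mx _ _ _]mxE.
rewrite -mulr_suml mulrN lerNl.
apply: (@le_trans _ _ t); last by rewrite ler_peMl.
rewrite /t (bigD1 k)//= (bigD1 i)//= addrCA -!addrA.
apply: le_trans (_ : `|y k i 0| <= _); first by rewrite -normrN ler_norm.
rewrite lerDl !addr_ge0// ?sumr_ge0// => k' _; exact: sumr_ge0.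
Qed.

(** Subtracting [x' - x] from a point feasible for [x'] makes it feasible for
    [x], because [A] is non-negative, and costs [c.(x' - x)]. *)
Lemma phi0_regular y : regular c (phi0 A h b y).
Proof.
split => [x|x x' xx'].
  rewrite fin_numN fin_numElt; apply/andP; split.
    have [z Fz] := feasible_nonempty y x.
    apply: (@lt_le_trans _ _ (dot c z)%:E); first exact: ltNyr.
    by apply: ereal_sup_ubound; exists z.
  apply: (@le_lt_trans _ _
    (dot b x + \sum_(k < K) dot (submxcol h k) (y k))%:E); last exact: ltry.
  apply: ge_ereal_sup => _ [z Fz <-]; rewrite lee_fin; exact: weak_duality.
split.
  rewrite leeN2; apply: ge_ereal_sup => _ [z [zx Azy] <-].
  apply: ereal_sup_ubound; exists z => //.
  by split => // i; exact: le_trans (zx i) (xx' i).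
rewrite /phi0 -leeBlDr// -fin_num_oppeD// leeN2.
apply: ge_ereal_sup => _ [z [zx Azy] <-].
rewrite -leeBlDr// -EFinB -dotBr; apply: ereal_sup_ubound.
exists (z - (x' - x)) => //; split => [i|k].
  by have := zx i; rewrite !mxE; lra.
move=> i; apply: le_trans (Azy k i).
apply: le_block_mul => l; have := xx' l; rewrite !mxE; lra.
Qed.

(** Only the groups not yet minimized over appear, so that the bound for stage
    [k.+1] is the one for stage [k] with the term of group [k] cancelled by its
    own cost. *)
Definition linear_bound (k : nat) y x : R :=
  - dot b x - \sum_(j < K | (k <= j)%N) dot (submxcol h j) (y j).

Lemma phi0_ge y x : ((linear_bound 0 y x)%:E <= phi0 A h b y x)%E.
Proof.
rewrite leeNr -EFinN; apply: ge_ereal_sup => _ [z Fz <-].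
by rewrite lee_fin /linear_bound opprB opprK addrC; exact: weak_duality.
Qed.

Context {d : measure_display} {T : measurableType d}.
Variable P : probability T R.

(** Regularity and the lower bound are proved together: the infimum at stage
    [k.+1] is known to be finite only through the lower bound at stage [k]. *)
Lemma phi_regular (D : 'I_K -> T -> m.-tuple nat) :
  (forall j, integrable_demand P (D j)) -> forall (k : nat) (kK : (k <= K)%N),
  (forall y, regular c (phi A h b P D kK y)) /\
  exists C : R, forall y x, ((linear_bound k y x - C)%:E <= phi A h b P D kK y x)%E.
Proof.
move=> iD; elim => [|k IH] kK.
  split; first exact: phi0_regular.
  by exists 0 => y x; rewrite subr0; exact: phi0_ge.
have [regk [C lbk]] := IH (ltnW kK); pose j := Ordinal kK.
pose C' := C + dot b (mean_demand P (D j)).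
pose F y v x := ((dot (submxcol h j) v)%:E + \int[P]_w phi A h b P D
  (ltnW kK) (dfwith y j v) (x + vec_of_tuple (D j w))%R)%E.
have regF y v : regular c (F y v).
  apply: regular_addl; apply: regular_expectation => //; exact: cvec_ge0.
have lbF y v x : ((linear_bound k.+1 y x - C')%:E <= F y v x)%E.
  pose r := linear_bound k (dfwith y j v) x - C.
  have sumE : \sum_(i < K | (k <= i)%N) dot (submxcol h i) (dfwith y j v i) =
      dot (submxcol h j) v + \sum_(i < K | (k < i)%N) dot (submxcol h i) (y i).
    rewrite (bigD1 j)//= dfwithin; congr (_ + _); apply: eq_big => [i|i].
      by rewrite -val_eqE /= ltn_neqAle eq_sym andbC.
    by rewrite eq_sym => /andP[_ ij]; rewrite dfwithout.
  have rE : linear_bound k.+1 y x - C' =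
      dot (submxcol h j) v + (r - dot b (mean_demand P (D j))).
    rewrite /r /C' /linear_bound sumE; ring.
  rewrite rE EFinD leeD2l// EFinB -integral_dot// -(integral_EFin_cst P r).
  rewrite -integralB//; last 2 first.
  - exact: finite_measure_integrable_cst.
  - exact: integrable_dot.
  apply: le_integral => //.
  - apply: integrableB => //; last exact: integrable_dot.
    exact: finite_measure_integrable_cst.
  - exact: (integrable_regular cvec_ge0 x (regk (dfwith y j v)) (iD j)).
  move=> w _; apply: le_trans (lbk _ _).
  rewrite /= -EFinB lee_fin /r /linear_bound dotDr; lra.
split; last first.
  by exists C' => y x; apply: le_ereal_inf_tmp => _ [v _ <-]; exact: lbF.
by move=> y; apply: (regular_inf (F := F y) 0 (regF y)) => v x; exact: lbF.
Qed.

(** Each stage adds at most [e] to the error, uniformly in [y] and [x]. *)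
Lemma phi_compare (D E : 'I_K -> T -> m.-tuple nat) (e : R) :
  (forall j, integrable_demand P (D j)) ->
  (forall j, integrable_demand P (E j)) ->
  (forall j w i, tnth (E j w) i <= tnth (D j w) i)%N ->
  (forall j, dot c (mean_demand P (D j) - mean_demand P (E j)) <= e) ->
  forall (k : nat) (kK : (k <= K)%N) y x,
  (phi A h b P D kK y x <= phi A h b P E kK y x /\
   phi A h b P E kK y x <= phi A h b P D kK y x + (k%:R * e)%:E)%E.
Proof.
move=> iD iE ED gap; elim => [|k IH] kK y x.
  by rewrite mul0r adde0.
pose j := Ordinal kK.
apply: le_ereal_inf_shift => v.
have [le1 le2] := expectation_compare cvec_ge0 x
  ((phi_regular iD (ltnW kK)).1 (dfwith y j v))
  ((phi_regular iE (ltnW kK)).1 (dfwith y j v))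
  (iD j) (iE j) (ED j) (IH (ltnW kK) (dfwith y j v)).
split; first by rewrite leeD2l.
rewrite -addeA leeD2l//; apply: le_trans le2 _; rewrite leeD2l// lee_fin.
by rewrite -natr1 mulrDl mul1r lerD2l.
Qed.

End stage_costs.

(** * Truncation *)

Lemma cvg_finite_sum {R : realType} {I : finType} (f : nat -> I -> R)
    (l : I -> R) :
  (forall i, f M i @[M --> \oo] --> l i) ->
  \sum_i f M i @[M --> \oo] --> \sum_i l i.
Proof. by move=> fl; apply: cvg_big => //; exact: add_continuous. Qed.

Section truncation.
Context {R : realType} {m : nat} {d : measure_display} {T : measurableType d}.
Variable P : probability T R.

Lemma nat_mean_truncated_cvg (X : T -> nat) : discretely_measurable X ->
  (nat_mean P X < +oo)%E ->
  nat_mean P (fun w => minn (X w) M) @[M --> \oo] --> nat_mean P X.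
Proof.
move=> mX finX; apply: (@dominated_cvg _ _ _ P setT measurableT
  (fun M w => ((minn (X w) M)%:R : R)%:E) (fun w => ((X w)%:R : R)%:E)
  (fun w => ((X w)%:R : R)%:E)).
- by move=> M; exact: (discretely_measurable_fun
    (fun n : nat => ((minn n M)%:R : R)%:E) mX).
- move=> w _; apply: cvg_near_cst; exists (X w) => // M /= XM.
  by rewrite (minn_idPl XM).
- by [].
- apply/integrableP; split.
    exact: (discretely_measurable_fun (fun n : nat => (n%:R : R)%:E) mX).
  rewrite (eq_integral (fun w => ((X w)%:R : R)%:E)); first exact: finX.
  by move=> w _; rewrite /= ger0_norm.
- by move=> M w _; rewrite /= lee_fin ger0_norm// ler_nat geq_minl.
Qed.

Lemma integrable_demand_truncated (D : T -> m.-tuple nat) (M : nat) :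
  integrable_demand P D -> integrable_demand P (truncated M D).
Proof.
move=> [mD finD]; have mDM : discretely_measurable (truncated M D).
  exact: (discretely_measurable_comp
    (fun v : m.-tuple nat => [tuple minn (tnth v i) M | i < m]) mD).
split=> // i; apply: le_lt_trans (finD i); apply: le_nat_mean.
- exact: (discretely_measurable_comp (fun v : m.-tuple nat => tnth v i) mDM).
- exact: (discretely_measurable_comp (fun v : m.-tuple nat => tnth v i) mD).
- by move=> w; rewrite tnth_mktuple geq_minl.
Qed.

Lemma truncation_gap_cvg (c : 'cV[R]_m) (D : T -> m.-tuple nat) :
  integrable_demand P D ->
  dot c (mean_demand P D - mean_demand P (truncated M D)) @[M --> \oo] --> 0.
Proof.
move=> [mD finD].
have -> : (0 : R) = \sum_(i < m) c i 0 *
    (fine (nat_mean P (fun w => tnth (D w) i)) -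
     fine (nat_mean P (fun w => tnth (D w) i))).
  by rewrite big1// => i _; rewrite subrr mulr0.
rewrite /dot; apply: cvg_finite_sum => i.
under eq_fun do rewrite !mxE.
apply: cvgMl_tmp; apply: cvgB; first exact: cvg_cst.
apply: fine_cvg; rewrite fineK; last by rewrite ge0_fin_numE ?nat_mean_ge0.
rewrite (_ : (fun _ => _) = fun M => nat_mean P (fun w => minn (tnth (D w) i) M)).
  apply: nat_mean_truncated_cvg => //.
  exact: (discretely_measurable_comp (fun v : m.-tuple nat => tnth v i) mD).
by apply/funext => M; apply: eq_integral => w _; rewrite tnth_mktuple.
Qed.

End truncation.

Theorem theorem5 (R : realType) (m K : nat) (K_gt0 : (0 < K)%N)
    (sz : 'I_K -> nat)
    (A : 'M[nat]_((\sum_(k < K) sz k)%N, m))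
    (A_row : forall j, exists i, A j i != 0%N)
    (A_col : forall i, exists j, A j i != 0%N)
    (h : 'cV[R]_((\sum_(k < K) sz k)%N)) (h_gt0 : forall j, 0 < h j 0)
    (b : 'cV[R]_m) (b_gt0 : forall i, 0 < b i 0)
    (* lead times *)
    (L : nat -> R) (L0 : L 0%N = 0)
    (L_lt : forall k, (k < K)%N -> L k < L k.+1)
    (* demand process X, with order arrivals N and order sizes S *)
    (d' : measure_display) (T' : measurableType d') (Q : probability T' R)
    (rate : R) (rate_gt0 : 0 < rate)
    (N : R -> {RV Q >-> nat}) (S : nat -> {RV Q >-> m.-tuple nat})
    (X : R -> T' -> m.-tuple nat)
    (X_cpp : compound_poisson_process rate N S X)
    (S_moment : forall i : 'I_m,
       (\int[Q]_w ((tnth (S 0%N w) i)%:R ^+ 6 : R)%:E < +oo)%E)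
    (* lead time demands *)
    (d : measure_display) (T : measurableType d) (P : probability T R)
    (D : 'I_K -> {RV P >-> m.-tuple nat})
    (D_indep : mutually_independent P (fun k : 'I_K => sigma_rv (D k)))
    (t : R) (t_ge : L K <= t)
    (D_law : forall k : 'I_K,
       same_law P (D k) Q
         (fun w => diff_tuple (X (t - L k) w) (X (t - L k.+1) w))) :
  (forall (k : nat) (kK : (k < K)%N),
     uniform_cvg
       (fun (M : nat) (u : (forall j, 'cV[R]_(sz j)) * 'cV[R]_m) =>
          phi A h b P (fun j => truncated M (D j)) (ltnW kK) u.1 u.2)
       (fun u : (forall j, 'cV[R]_(sz j)) * 'cV[R]_m =>
          phi A h b P (fun j => D j) (ltnW kK) u.1 u.2))
  /\
  uniform_cvg
    (fun (M : nat) (_ : unit) =>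
       phi_top A h b P (fun j => truncated M (D j)))
    (fun _ : unit => phi_top A h b P (fun j => D j)).
Proof.
have mono i j : (i <= j)%N -> (j <= K)%N -> L i <= L j.
  elim: j => [|j IH]; first by rewrite leqn0 => /eqP ->.
  rewrite leq_eqVlt => /orP[/eqP -> //|ij jK].
  rewrite ltnS in ij; have := L_lt j jK; move/ltW.
  exact: le_trans (IH ij (ltnW jK)).
have iD j : integrable_demand P (D j).
  split=> [|i]; first exact: discretely_measurable_RV (@measurable_tuple_nat m).
  apply: (nat_mean_lead_time_demand rate_gt0 X_cpp _ _ (S_moment i) (D_law j)).
    by rewrite subr_ge0; exact: le_trans (mono _ _ (ltn_ord j) (leqnn K)) t_ge.
  by rewrite ltrD2l ltrN2; exact: L_lt.
pose c := cvec A h b.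
pose gap M j := dot c (mean_demand P (D j) - mean_demand P (truncated M (D j))).
have gap_ge0 M j : 0 <= gap M j.
  apply: dot_ge0 => [|i]; first exact: cvec_ge0.
  rewrite !mxE subr_ge0; have iM := integrable_demand_truncated M (iD j).
  apply: fine_le; rewrite ?ge0_fin_numE ?nat_mean_ge0 ?(iD j).2 ?iM.2//.
  have proj E : discretely_measurable E ->
      discretely_measurable (fun w : T => tnth (E w : m.-tuple nat) i).
    exact: (discretely_measurable_comp (fun v : m.-tuple nat => tnth v i)).
  apply: le_nat_mean; [exact: proj iM.1|exact: proj (iD j).1|].
  by move=> w; rewrite tnth_mktuple geq_minl.
have sum_gap0 : \sum_(j < K) gap M j @[M --> \oo] --> 0.
  have := cvg_finite_sum (fun j => truncation_gap_cvg c (iD j)).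
  by rewrite [X in _ --> X]big1_eq.
(* The sum of the gaps bounds each of them, so it serves as the error of a stage;
   e / (k + 1) keeps the quotient defined at k = 0. *)
have uniform k (kK : (k <= K)%N) (e : R) : 0 < e -> \forall M \near \oo,
    forall (y : forall j, 'cV[R]_(sz j)) (x : 'cV[R]_m),
    (`|phi A h b P (fun j => truncated M (D j)) kK y x -
       phi A h b P (fun j => D j) kK y x| < e%:E)%E.
  move=> e0; have eK : 0 < e / k.+1%:R by rewrite divr_gt0.
  have /cvgrPdist_lt/(_ _ eK) := sum_gap0; apply: filterS => M.
  rewrite sub0r normrN ger0_norm ?sumr_ge0// => small y x.
  have iM j := integrable_demand_truncated M (iD j).
  have [le1 le2] := @phi_compare _ _ _ _ A h b A_row h_gt0 b_gt0 _ _ P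
    (fun j => D j) (fun j => truncated M (D j)) (\sum_(j < K) gap M j)
    iD iM (fun j w i => ltac:(by rewrite tnth_mktuple geq_minl))
    (fun j => ltac:(by rewrite (bigD1 j)//= lerDl sumr_ge0)) k kK y x.
  have [finD _] := (phi_regular A_row h_gt0 b_gt0 iD kK).1 y.
  have [finM _] := (phi_regular A_row h_gt0 b_gt0 iM kK).1 y.
  move: le1 le2; rewrite -(fineK (finD x)) -(fineK (finM x)) -!EFinD !lee_fin.
  move=> le1 le2; rewrite /= lte_fin ger0_norm ?subr_ge0//.
  move: small; rewrite ltr_pdivlMr// -natr1 mulrDr mulr1 mulrC => small.
  have : 0 <= \sum_(j < K) gap M j by exact: sumr_ge0.
  lra.
split => [k kK e e0|e e0].
  by have := uniform k (ltnW kK) e e0; apply: filterS => M + u; apply.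
by have := uniform K (leqnn K) e e0; apply: filterS => M + _; apply.
Qed.
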